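(* Let $x$ be a real number and let $N = KJ$ with $K, J$ positive integers. Then $$f(N,x) = f(K,x)\cdot f(J,x^K).$$
   Context: For a positive integer $N$ and a real number $x$, the geometric series on $x$ with $N$ terms is $f(N,x) = \sum_{n=0}^{N-1} x^n$ (with $x^0 = 1$). *)

(* Defs.v *)
From mathcomp Require Import all_boot all_order all_algebra.
From mathcomp Require Import reals.

Set Implicit Arguments.
Unset Strict Implicit.
Unset Printing Implicit Defensive.

Import GRing.Theory.
Local Open Scope ring_scope.

Definition geometric_series (R : realType) (N : nat) (x : R) : R :=
  \sum_(0 <= n < N) x ^+ n.

(* Main.v *)
Require Import Defs.
From mathcomp Require Import all_boot all_order all_algebra.
From mathcomp Require Import reals.

Set Implicit Arguments.
Unset Strict Implicit.
Unset Printing Implicit Defensive.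

Import GRing.Theory.
Local Open Scope ring_scope.

(** Cut the [K * J] terms into [J] consecutive blocks of [K] terms.  The block
    of index [j] is [x ^+ (K * j)], that is [(x ^+ K) ^+ j], times the first
    block, so summing over [j] leaves a geometric series in [x ^+ K].  The
    blocks are split off one at a time by [geometric_seriesD]; this avoids
    dividing by [1 - x], so [x = 1] needs no separate treatment. *)

Lemma geometric_seriesD (R : realType) (x : R) (M N : nat) :
  geometric_series (M + N) x =
    geometric_series M x + x ^+ M * geometric_series N x.
Proof.
rewrite /geometric_series (big_cat_nat (n := M)) ?leq_addr //=; congr (_ + _).
rewrite -{1}[M]add0n big_addn addKn big_distrr /=.
by apply: eq_bigr => i _; rewrite addnC exprD.
Qed.

Theorem theorem1 (R : realType) (x : R) (N K J : nat)
  (hK : (0 < K)%N) (hJ : (0 < J)%N) (hN : N = (K * J)%N) :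
  geometric_series N x = geometric_series K x * geometric_series J (x ^+ K).
Proof.
rewrite {N}hN {hJ}; elim: J => [|J IHJ].
  by rewrite muln0 /geometric_series !(big_geq (leqnn 0)) mulr0.
rewrite mulnSr geometric_seriesD IHJ exprM.
rewrite [geometric_series J.+1 _]big_nat_recr //= mulrDr.
by rewrite [_ * (x ^+ K) ^+ J]mulrC.
Qed.
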